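(* Suppose $\kappa$ is weakly Mahlo, and $\xi<\kappa^+$. For any formula $\varphi$ which is either $\Pi^1_\xi$ or $\Sigma^1_\xi$ over $V_\kappa$, there is a club $D\subseteq\kappa$ such that for all regular uncountable $\alpha\in D$, $\varphi|^\kappa_\alpha$ is defined, and the set $D_\alpha$ of all ordinals $\beta<\alpha$ such that $(\varphi|^\kappa_\alpha)|^\alpha_\beta$ is defined and $(\varphi|^\kappa_\alpha)|^\alpha_\beta=\varphi|^\kappa_\beta$, is in the club filter on $\alpha$.
   Context: A cardinal $\kappa$ is weakly Mahlo if it is regular and uncountable and the set of regular cardinals below $\kappa$ is stationary in $\kappa$. Canonical functions. For every regular cardinal $\kappa$ and every ordinal $\xi$ with $\kappa\le\xi<\kappa^+$ fix a bijection $b_{\kappa,\xi}:\kappa\to\xi$, with $b_{\kappa,\kappa}=\mathrm{id}_\kappa$. For $\xi<\kappa^+$ and $\alpha<\kappa$ let $F^\kappa_\xi(\alpha)=\xi$ if $\xi<\kappa$, and $F^\kappa_\xi(\alpha)=b_{\kappa,\xi}[\alpha]$ if $\kappa\le\xi<\kappa^+$. Let $f^\kappa_\xi(\alpha)=\mathrm{ot}(F^\kappa_\xi(\alpha))$ and let $\pi^\kappa_{\xi,\alpha}:F^\kappa_\xi(\alpha)\to f^\kappa_\xi(\alpha)$ be the transitive collapse. Formulas. A formula is $\Pi^1_0$ (equivalently $\Sigma^1_0$) over $V_\kappa$ if it is a first-order formula in the language of set theory, where free variables and parameters of two types are allowed: first-order ones (ranging over, resp. being, elements of $V_\kappa$)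 and second-order ones (ranging over, resp. being, subsets of $V_\kappa$). It is $\Pi^1_{\xi+1}$ over $V_\kappa$ if it has the form $\forall X_{k_1}\cdots\forall X_{k_m}\psi$ with $\psi$ a $\Sigma^1_\xi$ formula over $V_\kappa$, and $\Sigma^1_{\xi+1}$ over $V_\kappa$ if it has the form $\exists X_{k_1}\cdots\exists X_{k_m}\psi$ with $\psi$ a $\Pi^1_\xi$ formula over $V_\kappa$ ($m\in\omega$; the quantifiers displayed are second-order). For $\xi$ a limit, a formula with finitely many second-order free variables and finitely many second-order parameters is $\Pi^1_\xi$ over $V_\kappa$ if it has the form $\bigwedge_{\zeta<\xi}\varphi_\zeta$ with each $\varphi_\zeta$ being $\Pi^1_\zeta$ over $V_\kappa$, and $\Sigma^1_\xi$ over $V_\kappa$ if it has the form $\bigvee_{\zeta<\xi}\varphi_\zeta$ with each $\varphi_\zeta$ being $\Sigma^1_\zeta$ over $V_\kappa$. Restriction. For $\varphi$ a $\Pi^1_\xi$ or $\Sigma^1_\xi$ formula over $V_\kappa$, $\xi<\kappa^+$, and $\alpha<\kappa$ regular, $\varphi|^\kappa_\alpha$ is defined by recursion on $\xi$. If $\xi<\kappa$, replace each second-order parameter $A_i$ by $A_i\cap V_\alpha$. If $\xi=\zeta+1>\kappa$, the restriction of $\forall\vec X\psi$ is $\forall\vec X(\psi|^\kappa_\alpha)$ and that of $\exists\vec X\psi$ is $\exists\vec X(\psi|^\kappa_\alpha)$. If $\xi\ge\kappa$ is a limit and $\varphi=\bigwedge_{\zeta<\xi}\psi_\zeta$, then $\varphi|^\kappa_\alpha=\bigwedge_{\zeta<f^\kappa_\xi(\alpha)}\psi_{(\pi^\kappa_{\xi,\alpha})^{-1}(\zeta)}|^\kappa_\alpha$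 in case $\psi_{(\pi^\kappa_{\xi,\alpha})^{-1}(\zeta)}|^\kappa_\alpha$ is a $\Pi^1_\zeta$ formula over $V_\alpha$ for every $\zeta<f^\kappa_\xi(\alpha)$; otherwise $\varphi|^\kappa_\alpha$ is undefined. Similarly for $\Sigma^1_\xi$ with $\bigvee$. Whenever $\varphi|^\kappa_\alpha$ is defined it is a $\Pi^1_{f^\kappa_\xi(\alpha)}$ (resp. $\Sigma^1_{f^\kappa_\xi(\alpha)}$) formula over $V_\alpha$, and $(\varphi|^\kappa_\alpha)|^\alpha_\beta$ is its restriction as a formula over $V_\alpha$, computed with the functions $F^\alpha_\eta,f^\alpha_\eta,\pi^\alpha_{\eta,\beta}$. The club filter on $\alpha$ consists of the subsets of $\alpha$ that contain a closed unbounded subset of $\alpha$. *)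

(* Defs.v *)
From mathcomp Require Import all_boot.
From mathcomp Require Import boolp classical_sets functions cardinality.

Set Implicit Arguments.
Unset Strict Implicit.
Unset Printing Implicit Defensive.

Local Open Scope classical_set_scope.

(** * The universe of sets

    [V] is the type of well-founded trees modulo bisimilarity (Aczel's
    interpretation of sets).  [V_ext], [V_wf], [V_range], [V_small],
    [V_union] and [V_power] below show that it is a universe of ZFC set theory
    in which equality of sets is Leibniz equality. *)

Inductive tree : Type := node (A : Type) (f : A -> tree).

Fixpoint bisim (x y : tree) : Prop :=
  match x, y with
  | node A f, node B g =>
      (forall a, exists b, bisim (f a) (g b)) /\
      (forall b, exists a, bisim (f a) (g b))
  end.

Record V : Type := MkV { trees : set tree; treesP : exists t, trees = bisim t }.

Definition toV (t : tree) : V := MkV (ex_intro _ t erefl).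

Definition mem (x y : V) : Prop :=
  exists (A : Type) (f : A -> tree) (a : A), y = toV (node f) /\ x = toV (f a).

Notation "x ∈ y" := (mem x y) (at level 70, no associativity).
Notation "x ⊆ y" := (forall z : V, z ∈ x -> z ∈ y) (at level 70, no associativity).

Definition elts (x : V) : set V := [set y | y ∈ x].

Definition el (x : V) : Type := {y : V | y ∈ x}.

Lemma bisim_refl t : bisim t t.
Proof. by elim: t => A f IH /=; split=> a; exists a. Qed.

Lemma bisim_sym t u : bisim t u -> bisim u t.
Proof.
elim: t u => A f IH [B g] /= [h1 h2]; split.
- by move=> b; have [a /IH] := h2 b; exists a.
- by move=> a; have [b /IH] := h1 a; exists b.
Qed.

Lemma bisim_trans t u v : bisim t u -> bisim u v -> bisim t v.
Proof.
elim: t u v => A f IH [B g] [C h] /= [p1 p2] [q1 q2]; split.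
- by move=> a; have [b ab] := p1 a; have [c bc] := q1 b; exists c; apply: IH bc.
- by move=> c; have [b bc] := q2 c; have [a ab] := p2 b; exists a; apply: IH bc.
Qed.

Lemma V_eqP (x y : V) : x = y <-> trees x = trees y.
Proof.
split=> [->//|]; case: x y => [s p] [s' q] /= e; subst s'.
by congr MkV; apply: Prop_irrelevance.
Qed.

Lemma toVP t u : toV t = toV u <-> bisim t u.
Proof.
rewrite V_eqP /=; split=> [e|tu]; first by rewrite e; exact: bisim_refl.
apply/funext=> v; apply/propext; split; last exact: bisim_trans.
by apply: bisim_trans; apply: bisim_sym.
Qed.

Lemma toV_surj (x : V) : exists t, x = toV t.
Proof. by case: x => s [t e]; exists t; apply/V_eqP. Qed.

Lemma mem_toV x A (f : A -> tree) :
  x ∈ toV (node f) <-> exists a, x = toV (f a).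
Proof.
split=> [[B [g [b [/toVP /= [_ h] ->]]]]|[a ->]]; last by exists A, f, a.
by have [a ab] := h b; exists a; apply/esym/toVP.
Qed.

Lemma V_ext (x y : V) : (forall z, z ∈ x <-> z ∈ y) -> x = y.
Proof.
have [[A f] ->] := toV_surj x; have [[B g] ->] := toV_surj y => h.
apply/toVP => /=; split=> [a|b].
- have /h/mem_toV[b /toVP] : toV (f a) ∈ toV (node f) by apply/mem_toV; exists a.
  by exists b.
- have /h/mem_toV[a /esym/toVP] : toV (g b) ∈ toV (node g).
    by apply/mem_toV; exists b.
  by exists a.
Qed.

Lemma V_wf : well_founded mem.
Proof.
move=> x; have [t ->] := toV_surj x.
by elim: t => A f IH; constructor=> y /mem_toV[a ->].
Qed.

(** Here A ranges over the universe of the types of branchings of trees; pairing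
    and infinity are the cases A = bool and A = nat. *)
Lemma V_range (A : Type) (F : A -> V) :
  exists y, forall z, z ∈ y <-> exists a, z = F a.
Proof.
have [g gP] := choice (fun a => toV_surj (F a)).
exists (toV (node g)) => z; rewrite mem_toV.
by split=> -[a ->]; exists a; rewrite gP.
Qed.

(** Replacement, and with [P] also separation. *)
Lemma V_small (x : V) (P : el x -> Prop) (F : el x -> V) :
  exists y, forall z, z ∈ y <-> exists2 i, P i & z = F i.
Proof.
have [[A f] ex] := toV_surj x.
have m a : toV (f a) ∈ x by rewrite ex; apply/mem_toV; exists a.
pose e a : el x := exist (fun y => y ∈ x) _ (m a).
have [y yP] := V_range (fun a : {a | P (e a)} => F (e (sval a))).
exists y => z; rewrite yP; split.
- by move=> [[a Pa] ->]; exists (e a).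
- case=> -[i ix] Pi ->; have := ix; rewrite {1}ex => /mem_toV[a ia]; subst i.
  have E : ix = m a by apply: Prop_irrelevance.
  by rewrite E in Pi *; exists (exist _ a Pi).
Qed.

Lemma V_union (x : V) : exists y, forall z, z ∈ y <-> exists2 w, w ∈ x & z ∈ w.
Proof.
have [[A f] ex] := toV_surj x.
pose B t := let: node B _ := t in B.
pose sub t : B t -> tree := let: node _ g := t in g.
have memB t z : z ∈ toV t <-> exists c, z = toV (@sub t c).
  by case: t => C g; rewrite mem_toV.
have [y yP] := V_range (fun p : {a : A & B (f a)} => toV (@sub _ (projT2 p))).
exists y => z; rewrite yP; split.
- move=> [[a c] ->]; exists (toV (f a)); first by rewrite ex; apply/mem_toV; exists a.
  by apply/memB; exists c.
- move=> [w]; rewrite ex => /mem_toV[a ->] /memB[c ->].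
  by exists (existT _ a c).
Qed.

Lemma V_power (x : V) : exists y, forall z, z ∈ y <-> z ⊆ x.
Proof.
have [[A f] ex] := toV_surj x.
exists (toV (@node (A -> Prop) (fun P => @node {a | P a} (fun a => f (sval a))))) => z.
rewrite mem_toV; split.
- by move=> [P ->] w /mem_toV[[a Pa] ->]; rewrite ex; apply/mem_toV; exists a.
- move=> zx; exists (fun a => toV (f a) ∈ z); apply: V_ext => w; rewrite mem_toV.
  split=> [wz|[[a az] ->//]].
  have := zx _ wz; rewrite ex => /mem_toV[a wa]; subst w.
  by exists (exist _ a wz).
Qed.

Definition V0 : V := toV (node (fun e : False => match e with end)).

(** * Ordinals, cardinals, clubs *)

Definition transitive_set (x : V) : Prop := forall y, y ∈ x -> y ⊆ x.

Definition ordinal (x : V) : Prop :=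
  transitive_set x /\ forall y, y ∈ x -> transitive_set y.

Definition is_zero (x : V) : Prop := forall y, ~ y ∈ x.

Definition is_succ (z x : V) : Prop := forall y, y ∈ x <-> y ∈ z \/ y = z.

Definition is_limit (x : V) : Prop :=
  [/\ ordinal x, exists y, y ∈ x
    & forall y, y ∈ x -> exists2 z, z ∈ x & y ∈ z].

Definition cardinal (k : V) : Prop :=
  ordinal k /\ forall d, d ∈ k -> ~ (elts d #= elts k)%card.

Definition uncountable (k : V) : Prop := ~ countable (elts k).

Definition regular (k : V) : Prop :=
  [/\ cardinal k, infinite_set (elts k)
    & forall (d : V) (f : V -> V), d ∈ k -> (forall x, x ∈ d -> f x ∈ k) ->
        exists2 g, g ∈ k & forall x, x ∈ d -> f x ∈ g].

Definition card_succ (k kp : V) : Prop :=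
  [/\ cardinal kp, k ∈ kp & forall m, cardinal m -> k ∈ m -> kp ⊆ m].

Definition club (k : V) (D : set V) : Prop :=
  [/\ D `<=` elts k,
      forall g, g ∈ k -> exists2 d, D d & g ∈ d
    & forall l, l ∈ k -> is_limit l ->
        (forall g, g ∈ l -> exists d, [/\ D d, d ∈ l & g ∈ d]) -> D l].

Definition stationary (k : V) (S : set V) : Prop :=
  forall C, club k C -> S `&` C !=set0.

Definition club_filter (a : V) (X : set V) : Prop :=
  X `<=` elts a /\ exists2 C, club a C & C `<=` X.

Definition weakly_mahlo (k : V) : Prop :=
  [/\ regular k, uncountable k & stationary k [set a | a ∈ k /\ regular a]].

(** [cumul a x] says that x belongs to V_a, i.e. x ⊆ V_b for some b < a. *)
Inductive cumul : V -> set V :=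
| cumul_intro (a b x : V) :
    b ∈ a -> (forall y, y ∈ x -> cumul b y) -> cumul a x.

(** * Canonical functions *)

Definition canonical_bijections (b : V -> V -> V -> V) : Prop :=
  (forall k kp xi, regular k -> card_succ k kp -> k ⊆ xi -> xi ∈ kp ->
     set_bij (elts k) (elts xi) (b k xi)) /\
  (forall k x, regular k -> x ∈ k -> b k k x = x).

Definition canF (b : V -> V -> V -> V) (k xi a : V) : set V :=
  [set y | if `[< xi ∈ k >] then y ∈ xi else exists2 i, i ∈ a & y = b k xi i].

(** The transitive collapse of A is the unique isomorphism of (A, ∈) onto a
    transitive set; when A is a set of ordinals, that transitive set is the
    order type of A. *)
Definition is_collapse (A : set V) (tp : V * (V -> V)) : Prop :=
  [/\ transitive_set tp.1, set_bij A (elts tp.1) tp.2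
    & forall x y, A x -> A y -> (x ∈ y <-> tp.2 x ∈ tp.2 y)].

Definition collapse (A : set V) : V * (V -> V) :=
  if pselect (exists tp, is_collapse A tp) is left h then sval (cid h)
  else (V0, id).

Definition canf (b : V -> V -> V -> V) (k xi a : V) : V :=
  (collapse (canF b k xi a)).1.

Definition canpi (b : V -> V -> V -> V) (k xi a : V) : V -> V :=
  (collapse (canF b k xi a)).2.

(** * Formulas

    Subsets of V_k are represented by classes [A : set V] included in V_k. *)

Inductive term : Type :=
| Var1 (n : nat)
| Par1 (x : V)
| Var2 (n : nat)
| Par2 (A : set V).

Inductive fo : Type :=
| Mem (t u : term)
| Eq (t u : term)
| Neg (p : fo)
| And (p q : fo)
| Or (p q : fo)
| Imp (p q : fo)
| All (n : nat) (p : fo)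
| Ex (n : nat) (p : fo).

Inductive side : Type := Pi | Sigma.

Definition dual (s : side) : side := if s is Pi then Sigma else Pi.

(** [Quant Pi k] is ∀X_k and [Quant Sigma k] is ∃X_k;
    [Big Pi xi psi] is ⋀_(z < xi) psi_z and [Big Sigma xi psi] is
    ⋁_(z < xi) psi_z. *)
Inductive form : Type :=
| FO (p : fo)
| Quant (s : side) (k : nat) (phi : form)
| Big (s : side) (xi : V) (psi : el xi -> form).

Definition quants (s : side) (ks : seq nat) (phi : form) : form :=
  foldr (Quant s) phi ks.

Fixpoint occ (p : fo) : set term :=
  match p with
  | Mem t u | Eq t u => [set t; u]
  | Neg p | All _ p | Ex _ p => occ p
  | And p q | Or p q | Imp p q => occ p `|` occ q
  end.

Fixpoint par1 (phi : form) : set V :=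
  match phi with
  | FO p => [set x | occ p (Par1 x)]
  | Quant _ _ phi => par1 phi
  | Big _ _ psi => [set x | exists i, par1 (psi i) x]
  end.

Fixpoint par2 (phi : form) : set (set V) :=
  match phi with
  | FO p => [set A | occ p (Par2 A)]
  | Quant _ _ phi => par2 phi
  | Big _ _ psi => [set A | exists i, par2 (psi i) A]
  end.

Fixpoint free2 (phi : form) : set nat :=
  match phi with
  | FO p => [set k | occ p (Var2 k)]
  | Quant _ k phi => free2 phi `\ k
  | Big _ _ psi => [set k | exists i, free2 (psi i) k]
  end.

Definition over (k : V) (phi : form) : Prop :=
  par1 phi `<=` cumul k /\ forall A, par2 phi A -> A `<=` cumul k.

(** [lev k s xi phi]: phi is Π^1_xi (s = Pi) or Σ^1_xi (s = Sigma) over V_k. *)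
Inductive lev (k : V) : side -> V -> form -> Prop :=
| lev_zero s xi p : is_zero xi -> over k (FO p) -> lev k s xi (FO p)
| lev_succ s z xi ks psi :
    is_succ z xi -> lev k (dual s) z psi -> lev k s xi (quants s ks psi)
| lev_limit s xi (psi : el xi -> form) :
    is_limit xi ->
    finite_set (free2 (Big s psi)) -> finite_set (par2 (Big s psi)) ->
    (forall i, lev k s (sval i) (psi i)) -> lev k s xi (Big s psi).

(** * Restriction *)

Definition cut_term (a : V) (t : term) : term :=
  if t is Par2 A then Par2 (A `&` cumul a) else t.

Fixpoint cut_fo (a : V) (p : fo) : fo :=
  match p with
  | Mem t u => Mem (cut_term a t) (cut_term a u)
  | Eq t u => Eq (cut_term a t) (cut_term a u)
  | Neg p => Neg (cut_fo a p)
  | And p q => And (cut_fo a p) (cut_fo a q)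
  | Or p q => Or (cut_fo a p) (cut_fo a q)
  | Imp p q => Imp (cut_fo a p) (cut_fo a q)
  | All n p => All n (cut_fo a p)
  | Ex n p => Ex n (cut_fo a p)
  end.

Fixpoint cut (a : V) (phi : form) : form :=
  match phi with
  | FO p => FO (cut_fo a p)
  | Quant s k phi => Quant s k (cut a phi)
  | Big s xi psi => Big s (fun i => cut a (psi i))
  end.

Definition cut_over (a : V) (phi : form) : option form :=
  if `[< over a (cut a phi) >] then Some (cut a phi) else None.

(** The recursion on xi is carried out along the formula: a formula of level xi
    is a block of second-order quantifiers in front of a first-order formula or
    of a conjunction/disjunction whose length is the largest limit ordinal
    below or equal to xi, so that the latter is below k iff xi is.  Since
    quantifiers commute with [cut_over], the case [Quant] serves all successor
    levels.  [None] means "undefined"; below level k this happens when a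
    first-order parameter lies outside V_a, so that cutting the second-order
    parameters does not yield a formula over V_a.  In the last case the
    family [chi] is unique, the collapse being onto [canf b k xi a]. *)
Fixpoint restr (b : V -> V -> V -> V) (k a : V) (phi : form) : option form :=
  match phi with
  | FO p => cut_over a (FO p)
  | Quant s n psi => omap (Quant s n) (restr b k a psi)
  | Big s xi psi =>
      if `[< xi ∈ k >] then cut_over a (Big s psi)
      else if pselect (exists chi : el (canf b k xi a) -> form,
          forall (y : el xi) (z : el (canf b k xi a)),
            canF b k xi a (sval y) -> canpi b k xi a (sval y) = sval z ->
            restr b k a (psi y) = Some (chi z) /\ lev a s (sval z) (chi z))
        is left h then Some (Big s (sval (cid h)))
      else None
  end.

(** [restricts b k s xi phi a chi]: phi is a Π^1_xi (resp. Σ^1_xi) formula over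
    V_k, and its restriction to a is defined and equal to chi.  The ordinal
    [a < k] need not be regular. *)
Definition restricts (b : V -> V -> V -> V) (k : V) (s : side) (xi : V)
    (phi : form) (a : V) (chi : form) : Prop :=
  lev k s xi phi /\ restr b k a phi = Some chi.

(* Main.v *)
(** Call a set of ordinals below a regular [k] large if it contains every limit
    [a < k] closed under some [g : k -> k]; large sets are in the club filter
    when [k] is uncountable, are closed under diagonal intersections, and
    reflect: if [X] is large in [k] then [X]
    is large in a large set of [a < k], with the same [g].

    That [phi|a] is defined for a large set of [a], and that restrictions
    commute, are proved by successive inductions on the level.  Below level [k],
    restriction only cuts second-order parameters and the first-order
    parameters are bounded in [k].  At a limit [xi >= k], for a large set of
    [a], [F_y a = F_xi a ∩ y] for all [y] in [F_xi a], so that the collapse of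
    [F_xi a] maps [y] to [f_y a], which is the level of [psi_y|a].  For the
    commutation, let [eta = f_xi a]; the collapse of [F_xi a] composed with
    [b k xi] and [b a eta] are two bijections from [a] onto [eta], so their
    images of [c] agree for a large set of [c < a]; hence the indices selected
    by [(phi|a)|c] are the images of those selected by [phi|c]. *)

From mathcomp Require Import all_boot.
From mathcomp Require Import boolp classical_sets functions cardinality.
Require Import Defs.

Set Implicit Arguments.
Unset Strict Implicit.
Unset Printing Implicit Defensive.

Local Open Scope classical_set_scope.

(** * Bijections between classes *)

Lemma set_bij_inj (T U : Type) (A : set T) (B : set U) (f : T -> U) x y :
  set_bij A B f -> A x -> A y -> f x = f y -> x = y.
Proof. by move=> [_ inj _] Ax Ay; apply: inj; rewrite inE. Qed.

Lemma set_bij_card (T U : Type) (A : set T) (B : set U) (f : T -> U) :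
  set_bij A B f -> (B #= A)%card.
Proof.
move=> [fAB inj surj]; have -> : B = f @` A.
  by apply/seteqP; split=> [//|_ [x Ax <-]]; exact: fAB.
exact: inj_card_eq.
Qed.

Lemma set_bij_comp (T U W : Type) (A : set T) (B : set U) (C : set W)
    (f : T -> U) (g : U -> W) :
  set_bij A B f -> set_bij B C g -> set_bij A C (g \o f).
Proof.
move=> fb gb; have [f1 _ f3] := fb; have [g1 _ g3] := gb; split.
- by move=> x /f1 /g1.
- move=> x y; rewrite !inE => Ax Ay /= e.
  by apply: (set_bij_inj fb) => //; apply: (set_bij_inj gb) => //; exact: f1.
- by move=> z /g3[y /f3[x Ax <-] <-]; exists x.
Qed.

Lemma set_bij_inverse (x y : V) (f : V -> V) : set_bij (elts x) (elts y) f ->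
  exists g : V -> V,
    [/\ forall v, v ∈ y -> g v ∈ x, forall v, v ∈ y -> f (g v) = v
      & forall u, u ∈ x -> g (f u) = u].
Proof.
move=> fb; have [f1 _ f3] := fb.
have h v : exists u, v ∈ y -> u ∈ x /\ f u = v.
  have [vy|nvy] := pselect (v ∈ y); last by exists v.
  by have [u ux <-] := f3 _ vy; exists u.
have [g gP] := choice h; exists g; split=> [v /gP[]//|v /gP[]//|u ux].
have [gx e] := gP _ (f1 _ ux).
exact: set_bij_inj fb gx ux e.
Qed.

(** * Ordinals *)

Lemma mem_ind (P : V -> Prop) :
  (forall x, (forall y, y ∈ x -> P y) -> P x) -> forall x, P x.
Proof. exact: well_founded_ind V_wf P. Qed.

Lemma mem_irr (x : V) : ~ x ∈ x.
Proof. by elim/mem_ind: x => x IH xx; case: (IH x xx). Qed.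

Lemma mem_asym (x y : V) : x ∈ y -> ~ y ∈ x.
Proof. by elim/mem_ind: x y => x IH y xy yx; exact: (IH y yx x yx xy). Qed.

Lemma mem_minimal (P : V -> Prop) : (exists x, P x) ->
  exists2 x, P x & forall y, y ∈ x -> ~ P y.
Proof.
move=> [x Px]; apply: contrapT => H.
by elim/mem_ind: x Px => x IH Px; apply: H; exists x.
Qed.

Lemma ordinal_el x y : ordinal x -> y ∈ x -> ordinal y.
Proof.
move=> [tx ex] yx; split; first exact: ex.
by move=> z zy; apply: ex; apply: tx zy.
Qed.

Lemma ordinal_trans x y z : ordinal x -> y ∈ x -> z ∈ y -> z ∈ x.
Proof. by move=> [tx _] yx; apply: tx. Qed.

Lemma ordinal_total x y : ordinal x -> ordinal y -> [\/ x ∈ y, x = y | y ∈ x].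
Proof.
elim/mem_ind: x y => x IHx y ox; elim/mem_ind: y => y IHy oy.
have [xy|nxy] := pselect (x ∈ y); first exact: Or31.
have [yx|nyx] := pselect (y ∈ x); first exact: Or33.
apply: Or32; apply: V_ext => z; split=> [zx|zy].
- have [//|e|yz] := IHx _ zx y (ordinal_el ox zx) oy; first by rewrite e in zx.
  by case: nyx; apply: ordinal_trans yz.
- have [xz|e|//] := IHy _ zy (ordinal_el oy zy); last by rewrite -e in zy.
  by case: nxy; apply: ordinal_trans xz.
Qed.

Lemma ordinal_sub_or_mem x y : ordinal x -> ordinal y -> x ⊆ y \/ y ∈ x.
Proof.
move=> ox oy; have [xy|->|yx] := ordinal_total ox oy; [left|by left|by right].
by move=> z; apply: ordinal_trans xy.
Qed.

Lemma ordinal_sub x y : ordinal x -> ordinal y -> x ⊆ y -> x ∈ y \/ x = y.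
Proof.
move=> ox oy xy; have [|->|yx] := ordinal_total ox oy; [by left|by right|].
by case: (mem_irr (xy _ yx)).
Qed.

Lemma is_succ_exists x : exists y, is_succ x y.
Proof.
have [p pP] := V_range (fun _ : bool => x).
have [q qP] := V_range (fun c : bool => if c then x else p).
have [u uP] := V_union q.
exists u => z; rewrite uP; split=> [[w /qP[[] ->]]|[zx|->]].
- by left.
- by move=> /pP[_ ->]; right.
- by exists x => //; apply/qP; exists true.
- by exists p; [apply/qP; exists false|apply/pP; exists true].
Qed.

Definition succ (x : V) : V := sval (cid (is_succ_exists x)).

Lemma mem_succ x y : y ∈ succ x <-> y ∈ x \/ y = x.
Proof. exact: svalP (cid (is_succ_exists x)) y. Qed.

Lemma is_succE x y : is_succ x y -> y = succ x.
Proof. by move=> h; apply: V_ext => z; rewrite mem_succ; exact: h. Qed.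

Lemma mem_succ_self x : x ∈ succ x.
Proof. by apply/mem_succ; right. Qed.

Lemma ordinal_succ x : ordinal x -> ordinal (succ x).
Proof.
move=> ox; have [tx ex] := ox; split=> [y /mem_succ[yx|->] z zy|y /mem_succ[|->//]].
- by apply/mem_succ; left; apply: tx zy.
- by apply/mem_succ; left.
- exact: ex.
Qed.

Lemma ordinal_V0 : ordinal V0.
Proof. by split=> y /mem_toV[[]]. Qed.

Lemma notin_V0 x : ~ x ∈ V0.
Proof. by move=> /mem_toV[[]]. Qed.

Lemma is_zeroE x : is_zero x -> x = V0.
Proof. by move=> h; apply: V_ext => z; split=> [/h|/notin_V0]. Qed.

Lemma is_limit_succ l x : is_limit l -> x ∈ l -> succ x ∈ l.
Proof.
move=> [ol _ h] xl; have [y yl xy] := h _ xl.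
have oy := ordinal_el ol yl; have ox := ordinal_el oy xy.
have := ordinal_total (ordinal_succ ox) oy => -[||].
- exact: ordinal_trans yl.
- by move=> ->.
- move=> /mem_succ[yx|e]; first by case: (mem_asym xy yx).
  by case: (@mem_irr y); rewrite {1}e.
Qed.

Lemma V0_in_limit l : is_limit l -> V0 ∈ l.
Proof.
move=> [ol [x xl] _]; have [//|e|] := ordinal_total ordinal_V0 ol.
  by rewrite -e in xl; case: (notin_V0 xl).
by move=> /notin_V0.
Qed.

Lemma cumul_sub x y : ordinal y -> x ∈ y -> cumul x `<=` cumul y.
Proof.
move=> oy xy z h; case: h xy => a b w ba h ay.
exact: cumul_intro (ordinal_trans oy ay ba) h.
Qed.

(** * Regular cardinals *)

Lemma regular_ordinal k : regular k -> ordinal k.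
Proof. by case=> -[]. Qed.

Lemma regular_limit k : regular k -> is_limit k.
Proof.
move=> rk; have ok := regular_ordinal rk; have [_ inf reg] := rk.
have k1 : succ V0 ∈ k.
  have [h|//] := ordinal_sub_or_mem ok (ordinal_succ ordinal_V0).
  case: inf; apply: (sub_finite_set (B := [set V0])); last exact: finite_set1.
  by move=> x /h /mem_succ[x0|//]; case: (notin_V0 x0).
split=> // [|y yk]; first by exists (succ V0).
have [g gk yg] := reg _ (fun _ => y) k1 (fun _ _ => yk).
by exists g => //; apply: yg; exact: mem_succ_self.
Qed.

(** Regularity speaks of total functions on the universe. Here a choice of witnesses is bounded
    instead, and [R] may depend on the proof that the index lies in [d]. *)
Lemma regular_bound k d (R : el d -> V -> Prop) : regular k -> d ∈ k ->
  (forall i, exists2 y, y ∈ k & R i y) ->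
  exists2 g, g ∈ k & forall i, exists2 y, y ∈ g & R i y.
Proof.
move=> [_ _ reg] dk h.
have h' x : exists y, forall xd : x ∈ d, y ∈ k /\ R (exist _ x xd) y.
  have [xd|nxd] := pselect (x ∈ d); last by exists x.
  have [y yk Ry] := h (exist _ x xd); exists y => xd'.
  by rewrite (Prop_irrelevance xd' xd).
have [f fP] := choice h'.
have [|g gk gP] := reg d f dk; first by move=> x xd; case: (fP x xd).
by exists g => // -[x xd]; exists (f x); [exact: gP|case: (fP x xd)].
Qed.

Lemma regular_sup k d (f : V -> V) : regular k -> d ∈ k ->
  (forall x, x ∈ d -> f x ∈ k) -> exists2 g, g ∈ k & forall x, x ∈ d -> f x ∈ g.
Proof. by move=> [_ _ reg]; exact: reg. Qed.

Lemma regular_sup2 k d (f : V -> V -> V) : regular k -> d ∈ k ->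
  (forall x y, x ∈ d -> y ∈ d -> f x y ∈ k) ->
  exists2 g, g ∈ k & forall x y, x ∈ d -> y ∈ d -> f x y ∈ g.
Proof.
move=> rk dk h; have ok := regular_ordinal rk.
(* Regularity is applied twice: to each row [f x], then to the bounds of the rows. *)
have [|g gk gP] := @regular_bound k d
    (fun i g => forall y, y ∈ d -> f (sval i) y ∈ g) rk dk.
  by move=> [x xd]; apply: regular_sup => // y; exact: h.
exists g => // x y xd yd.
have [g' g'g h'] := gP (exist _ x xd).
exact: ordinal_trans (ordinal_el ok gk) g'g (h' y yd).
Qed.

Lemma regular_max k x y : regular k -> x ∈ k -> y ∈ k ->
  exists z, [/\ z ∈ k, x ∈ z & y ∈ z].
Proof.
move=> rk xk yk; have ok := regular_ordinal rk; have lk := regular_limit rk.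
have [xy|->|yx] := ordinal_total (ordinal_el ok xk) (ordinal_el ok yk).
- exists (succ y); split; [exact: is_limit_succ|by apply/mem_succ; left|].
  exact: mem_succ_self.
- by exists (succ y); split; [exact: is_limit_succ|exact: mem_succ_self|
    exact: mem_succ_self].
- exists (succ x); split; [exact: is_limit_succ|exact: mem_succ_self|].
  by apply/mem_succ; left.
Qed.

(** Otherwise [ap] is included in [e], hence injects into [a]; then [a] is an element of the
    cardinal [ap] equinumerous with it. *)
Lemma ordinal_card_succ a ap e : card_succ a ap -> ordinal e ->
  (elts e #= elts a)%card -> e ∈ ap.
Proof.
move=> [[oap cap] aap _] oe ea.
have [h|//] := ordinal_sub_or_mem oap oe; case: (cap a aap).
apply/card_eqPle; split.
- by apply: subset_card_le => x xa; apply: ordinal_trans xa.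
- rewrite -(card_le_eqr ea); exact: subset_card_le.
Qed.

(** The cardinal [k] bounds the search, so a least cardinal above [a] is found by well-foundedness
    alone. *)
Lemma card_succ_exists k a : cardinal k -> a ∈ k -> exists ap, card_succ a ap.
Proof.
move=> ck ak; have [|m [cm am] min] := @mem_minimal (fun m => cardinal m /\ a ∈ m).
  by exists k.
exists m; split=> // m' cm' am'.
have [//|m'm] := ordinal_sub_or_mem cm.1 cm'.1.
by case: (min _ m'm).
Qed.

(** * Clubs as sets of closure points *)

Definition closure_points (k : V) (g : V -> V) : set V :=
  [set a | [/\ a ∈ k, is_limit a & forall i, i ∈ a -> g i ∈ a]].

Definition large (k : V) (X : set V) : Prop :=
  exists2 g : V -> V, (forall i, i ∈ k -> g i ∈ k) & closure_points k g `<=` X.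

(** * The ordinal omega and bounds of countable sequences *)

Definition omega : V := sval (cid (V_range (fun n => iter n succ V0))).

Lemma mem_omega x : x ∈ omega <-> exists n, x = iter n succ V0.
Proof. exact: svalP (cid (V_range _)) x. Qed.

Lemma ordinal_nat n : ordinal (iter n succ V0).
Proof. by elim: n => [|n IH]; [exact: ordinal_V0|exact: ordinal_succ]. Qed.

Lemma mem_nat n x : x ∈ iter n succ V0 -> exists2 m, (m < n)%N & x = iter m succ V0.
Proof.
elim: n => [/notin_V0//|n IH /mem_succ[/IH[m mn ->]|->]]; last by exists n.
by exists m => //; exact: leq_trans mn _.
Qed.

Lemma nat_lt m n : (m < n)%N -> iter m succ V0 ∈ iter n succ V0.
Proof.
elim: n => // n IH; rewrite ltnS leq_eqVlt => /orP[/eqP->|/IH h].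
  exact: mem_succ_self.
by apply/mem_succ; left.
Qed.

Lemma nat_inj m n : iter m succ V0 = iter n succ V0 -> m = n.
Proof.
move=> e; have [mn|nm|//] := ltngtP m n.
- by have := nat_lt mn; rewrite e => /mem_irr.
- by have := nat_lt nm; rewrite e => /mem_irr.
Qed.

Lemma ordinal_omega : ordinal omega.
Proof.
split=> [x /mem_omega[n ->] y /mem_nat[m _ ->]|x /mem_omega[n ->]].
  by apply/mem_omega; exists m.
by case: (ordinal_nat n).
Qed.

Lemma regular_seq_bound k (u : nat -> V) : regular k -> uncountable k ->
  (forall n, u n ∈ k) -> exists2 g, g ∈ k & forall n, u n ∈ g.
Proof.
move=> rk unc uk; have ok := regular_ordinal rk.
have wk : omega ∈ k.
  (* If omega is not below [k], then [k] is included in omega and so is countable. *)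
  have [h|//] := ordinal_sub_or_mem ok ordinal_omega; case: unc.
  apply: (sub_countable (B := [set: nat])); last by [].
  apply: card_le_trans (card_image_le (fun n => iter n succ V0) setT).
  by apply: subset_card_le => x /h /mem_omega[n ->]; exists n.
have [i|g gk gP] := @regular_bound k omega
    (fun i y => forall n, sval i = iter n succ V0 -> y = u n) rk wk.
  have [n en] := (mem_omega (sval i)).1 (svalP i).
  by exists (u n) => // m; rewrite en => /nat_inj->.
exists g => // n; have nw : iter n succ V0 ∈ omega by apply/mem_omega; exists n.
by have [y yg /(_ n erefl) <-] := gP (exist (fun x => x ∈ omega) _ nw).
Qed.

(** Closed: each [i] in the limit [l] lies in a closure point below [l]. Unbounded: iterating a step
    function omega times from [c] gives a chain whose union is a closure point. *)
Lemma closure_points_club k g : regular k -> uncountable k ->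
  (forall i, i ∈ k -> g i ∈ k) -> club k (closure_points k g).
Proof.
move=> rk unc gk; have ok := regular_ordinal rk; have lk := regular_limit rk.
split=> [a []//|c ck|l lk' ll cof]; last first.
  split=> // i il; have [d [[_ _ dg] dl id]] := cof i il.
  by apply: ordinal_trans dl (dg _ id); case: ll.
have step x : exists y, x ∈ k ->
    [/\ y ∈ k, x ∈ y & forall i, i ∈ x -> g i ∈ y].
  have [xk|nxk] := pselect (x ∈ k); last by exists x.
  have [i /(ordinal_trans ok xk)/gk//|h hk hP] := @regular_sup k x g rk xk.
  have [z [zk xz hz]] := regular_max rk xk hk.
  exists z; split=> // i ix.
  exact: ordinal_trans (ordinal_el ok zk) hz (hP _ ix).
have [f fP] := choice step; pose u n := iter n f c.
have uk n : u n ∈ k by elim: n => //= n /fP[].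
have [r rP] := V_range u; have [a aP] := V_union r.
have memu x n : x ∈ u n -> x ∈ a.
  by move=> xu; apply/aP; exists (u n) => //; apply/rP; exists n.
have memE x : x ∈ a -> exists n, x ∈ u n.
  by move=> /aP[w /rP[n ->]]; exists n.
have ua n : u n ∈ a by apply: (memu _ n.+1); case: (fP _ (uk n)).
have oa : ordinal a.
  split=> [x /memE[n xu] y yx|x /memE[n xu]].
    by apply: (memu _ n); apply: ordinal_trans yx => //; apply: ordinal_el (uk n).
  by case: (ordinal_el (ordinal_el ok (uk n)) xu).
have ak : a ∈ k.
  have [h hk hP] := regular_seq_bound rk unc uk; have oh := ordinal_el ok hk.
  have [|ah|->//] := @ordinal_sub a h oa oh; last exact: ordinal_trans ah.
  by move=> x /memE[n xu]; apply: ordinal_trans xu.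
exists a; last exact: (ua 0).
split=> // [|i /memE[n iu]].
  split=> // [|x /memE[n xu]]; first by exists c; exact: (ua 0).
  by exists (u n).
by apply: (memu _ n.+1); case: (fP _ (uk n)) => _ _; apply.
Qed.

(** * Operations on large sets *)

Lemma large_sub k X Y :
  large k X -> (forall a, a ∈ k -> is_limit a -> X a -> Y a) -> large k Y.
Proof.
move=> [g gk gX] XY; exists g => // a ag; have [ak la _] := ag.
by apply: XY => //; exact: gX.
Qed.

Lemma large_fun k g : (forall i, i ∈ k -> g i ∈ k) ->
  large k [set a | forall i, i ∈ a -> g i ∈ a].
Proof. by move=> gk; exists g => // a []. Qed.

(** A single function [H] dominates all the [G i]: [H m] bounds every [G i j] with [i] and [j] at
    most [m], so closure under [H] implies closure under each [G i] with [i] in [a]. *)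
Lemma large_diag k (X : V -> set V) : regular k ->
  (forall i, i ∈ k -> large k (X i)) ->
  large k [set a | forall i, i ∈ a -> X i a].
Proof.
move=> rk h; have ok := regular_ordinal rk; have lk := regular_limit rk.
have h' i : exists g, i ∈ k ->
    (forall j, j ∈ k -> g j ∈ k) /\ closure_points k g `<=` X i.
  have [/h[g gk gX]|nik] := pselect (i ∈ k); first by exists g.
  by exists id => /nik.
have [G GP] := choice h'.
have h'' m : exists b, m ∈ k -> b ∈ k /\
    forall i j, i ∈ succ m -> j ∈ succ m -> G i j ∈ b.
  have [mk|nmk] := pselect (m ∈ k); last by exists m.
  have sk := is_limit_succ lk mk.
  have [i j im jm|b bk bP] := @regular_sup2 k (succ m) G rk sk; last by exists b.
  by apply: (GP i _).1; exact: ordinal_trans sk _.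
have [H HP] := choice h''; exists H => [m /HP[]//|a [ak la aH] i ia].
have oa := ordinal_el ok ak.
apply: (GP i _).2; first exact: ordinal_trans ia.
split=> // j ja.
(* The index [m] is the larger of [i] and [j]. *)
have [m [ma im jm]] : exists m, [/\ m ∈ a, i ∈ succ m & j ∈ succ m].
  have [ij|->|ji] := ordinal_total (ordinal_el oa ia) (ordinal_el oa ja).
  - by exists j; split=> //; [apply/mem_succ; left|exact: mem_succ_self].
  - by exists j; split=> //; exact: mem_succ_self.
  - by exists i; split=> //; [exact: mem_succ_self|apply/mem_succ; left].
have [_ h2] := HP m (ordinal_trans ok ak ma).
exact: ordinal_trans oa (aH _ ma) (h2 i j im jm).
Qed.

Lemma large_gt k c : c ∈ k -> large k [set a | c ∈ a].
Proof.
move=> ck; exists (fun _ => c) => // a [_ la ac]; apply: (ac V0).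
exact: V0_in_limit.
Qed.

(** This is a diagonal intersection with [X] at index 0 and [Y] at all others, since a limit
    contains both 0 and 1. *)
Lemma large_and k X Y : regular k -> large k X -> large k Y -> large k (X `&` Y).
Proof.
move=> rk lX lY; have lk := regular_limit rk.
have := large_diag (X := fun i => if pselect (i = V0) then X else Y) rk.
move=> /(_ _)/large_sub; apply=> [i _|a ak la h]; first by case: pselect.
have a0 := V0_in_limit la.
split; first by have := h _ a0; case: pselect.
have /= := h _ (is_limit_succ la a0); case: pselect => // e.
by case: (@notin_V0 V0); rewrite -[X in _ ∈ X]e; exact: mem_succ_self.
Qed.

Lemma large_reflect k X : ordinal k -> large k X -> large k (fun a => large a X).
Proof.
move=> ok [g gk gX]; exists g => // a [ak la ag]; exists g => // c [ca lc cg].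
by apply: gX; split=> //; exact: ordinal_trans ca.
Qed.

(** It suffices that [a] is closed under the two transition maps between the enumerations, each
    followed by the inverse of the other. *)
Lemma large_bij k y (c e : V -> V) : regular k ->
  set_bij (elts k) (elts y) c -> set_bij (elts k) (elts y) e ->
  large k [set a | c @` elts a = e @` elts a].
Proof.
move=> rk cb eb; have ok := regular_ordinal rk.
have [c' [c1 c2 c3]] := set_bij_inverse cb; have [e' [e1 e2 e3]] := set_bij_inverse eb.
have [ck _ _] := cb; have [ek _ _] := eb.
have l1 : large k [set a | forall i, i ∈ a -> c' (e i) ∈ a].
  by apply: large_fun => i /ek/c1.
have l2 : large k [set a | forall i, i ∈ a -> e' (c i) ∈ a].
  by apply: large_fun => i /ck/e1.
apply: large_sub (large_and rk l1 l2) _ => a ak la [h1 h2].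
apply/seteqP; split=> _ [i ia <-]; have ik := ordinal_trans ok ak ia.
- by exists (e' (c i)); [exact: h2|apply: e2; exact: ck].
- by exists (c' (e i)); [exact: h1|apply: c2; exact: ek].
Qed.

(** * Transitive collapses *)

Lemma is_collapse_mem A tp x w : is_collapse A tp -> A x ->
  w ∈ tp.2 x <-> exists y, [/\ A y, y ∈ x & w = tp.2 y].
Proof.
move=> [t [f1 _ f3] m] Ax; split=> [wx|[y [Ay yx ->]]]; last by apply/(m _ _ Ay Ax).
have [y Ay ew] := f3 _ (t _ (f1 _ Ax) _ wx); subst w.
by exists y; split=> //; apply/(m _ _ Ay Ax).
Qed.

(** By [is_collapse_mem], a collapse sends [x] to the set of values at the elements of [A] in [x],
    so induction on membership determines it. *)
Lemma is_collapse_unique A tp tp' : is_collapse A tp -> is_collapse A tp' ->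
  tp.1 = tp'.1 /\ forall x, A x -> tp.2 x = tp'.2 x.
Proof.
move=> h h'; have e x : A x -> tp.2 x = tp'.2 x.
  elim/mem_ind: x => x IH Ax; apply: V_ext => w.
  rewrite (is_collapse_mem _ h Ax) (is_collapse_mem _ h' Ax).
  by split=> -[y [Ay yx ->]]; exists y; split=> //; rewrite IH.
split=> //; apply: V_ext => w.
case: h h' => _ [f1 _ f3] _ [_ [g1 _ g3] _].
split=> [/f3[x Ax <-]|/g3[x Ax <-]]; first by rewrite e //; exact: g1.
by rewrite -e //; exact: f1.
Qed.

Lemma is_collapse_exists A x : ordinal x -> A `<=` elts x ->
  exists tp, is_collapse A tp.
Proof.
(* Mostowski recursion: [p z] is the set of all [p y] with [y] in both [A] and [z]. Injectivity on
   [A] comes from the linear order of ordinals. *)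
move=> ox Ax; pose step z (rec : forall y, y ∈ z -> V) :=
  sval (cid (@V_small z (fun i => A (sval i)) (fun i => rec _ (svalP i)))).
pose p := Fix V_wf (fun _ => V) step.
have pE z : p z = step z (fun y _ => p y).
  rewrite /p Fix_eq // => w f g fg; congr step.
  by apply: functional_extensionality_dep => y; apply: functional_extensionality_dep.
have pP z w : w ∈ p z <-> exists y, [/\ A y, y ∈ z & w = p y].
  rewrite pE; rewrite (svalP (cid (@V_small z _ _)) w).
  split=> [[[y yz] /= Ay ->]|[y [Ay yz ->]]]; first by exists y.
  by exists (exist _ y yz).
have inj y z : A y -> A z -> p y = p z -> y = z.
  move=> Ay Az e; have oy := ordinal_el ox (Ax _ Ay).
  have [yz|//|zy] := ordinal_total oy (ordinal_el ox (Ax _ Az)).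
    have : p y ∈ p z by apply/pP; exists y.
    by rewrite e => /mem_irr.
  have : p z ∈ p y by apply/pP; exists z.
  by rewrite e => /mem_irr.
have [t tP] := @V_small x (fun i => A (sval i)) (fun i => p (sval i)).
have tE w : w ∈ t <-> exists2 y, A y & w = p y.
  rewrite tP; split=> [[[y yx] Ay ->]|[y Ay ->]]; first by exists y.
  by exists (exist _ y (Ax _ Ay)).
exists (t, p); split=> /=.
- by move=> w /tE[y _ ->] z /pP[u [Au _ ->]]; apply/tE; exists u.
- split=> [y Ay|y z|w /tE[y Ay ->]]; [by apply/tE; exists y| |by exists y].
  by rewrite !inE; exact: inj.
- move=> y z Ay Az; split=> [yz|/pP[u [Au uz /inj->]]//].
  by apply/pP; exists y.
Qed.

Lemma collapseP A x : ordinal x -> A `<=` elts x -> is_collapse A (collapse A).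
Proof.
move=> ox Ax; rewrite /collapse.
case: pselect => [h|[]]; first exact: svalP (cid h).
exact: is_collapse_exists Ax.
Qed.

Lemma collapse_eq A tp : is_collapse A tp ->
  (collapse A).1 = tp.1 /\ forall x, A x -> (collapse A).2 x = tp.2 x.
Proof.
move=> h; apply: is_collapse_unique => //; rewrite /collapse.
by case: pselect => [h'|[]]; [exact: svalP (cid h')|exists tp].
Qed.

Lemma is_collapse_ordinal A x tp : ordinal x -> A `<=` elts x ->
  is_collapse A tp -> ordinal tp.1.
Proof.
move=> ox Ax h; have [t [_ _ f3] _] := h; split=> // w /f3[y Ay <-] z.
move=> /(is_collapse_mem _ h Ay)[u [Au uy ->]] v.
move=> /(is_collapse_mem _ h Au)[c [Ac cu ->]].
apply/(is_collapse_mem _ h Ay); exists c; split=> //.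
exact: ordinal_trans (ordinal_el ox (Ax _ Ay)) uy cu.
Qed.

Lemma is_collapse_iso A B p tp : set_bij A B p ->
  (forall x y, A x -> A y -> (x ∈ y <-> p x ∈ p y)) ->
  is_collapse B tp -> is_collapse A (tp.1, tp.2 \o p).
Proof.
move=> pb pm [t fb m]; split=> //=; first exact: set_bij_comp pb fb.
have [p1 _ _] := pb.
by move=> x y Ax Ay; rewrite pm // m //; exact: p1.
Qed.

(** The collapse of an initial segment is the restriction of the whole collapse, and its range is
    the value at the cut point. This later identifies f_y(a) with the image of [y]. *)
Lemma is_collapse_initial A tp x : transitive_set x -> is_collapse A tp -> A x ->
  is_collapse (A `&` elts x) (tp.2 x, tp.2).
Proof.
move=> tx h Ax; have [t fb m] := h; have [f1 _ _] := fb; split=> /=.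
- move=> w wx z zw; apply/(is_collapse_mem _ h Ax).
  have [y [Ay yx ew]] := (is_collapse_mem w h Ax).1 wx; subst w.
  have [u [Au uy eu]] := (is_collapse_mem z h Ay).1 zw; subst z.
  by exists u; split=> //; exact: tx uy.
- split=> [y [Ay yx]|y z|w].
  + by apply/(m _ _ Ay Ax).
  + by rewrite !inE => -[Ay _] [Az _]; exact: set_bij_inj fb Ay Az.
  + by move=> /(is_collapse_mem _ h Ax)[y [Ay yx ->]]; exists y.
- by move=> y z [Ay _] [Az _]; exact: m.
Qed.

Lemma is_collapse_transitive x : transitive_set x -> is_collapse (elts x) (x, id).
Proof. by move=> t; split=> //; split=> // y yx; exists y. Qed.

(** * Canonical functions *)

(** All that is needed of [b] at a single level, so that most lemmas below need no mention of the
    successor cardinal. *)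
Definition canonical_at (b : V -> V -> V -> V) (k xi : V) : Prop :=
  ordinal xi /\ (~ xi ∈ k -> set_bij (elts k) (elts xi) (b k xi)).

Lemma canonical_atP b k kp xi : canonical_bijections b -> regular k ->
  card_succ k kp -> xi ∈ kp -> canonical_at b k xi.
Proof.
move=> [Hb _] rk hp xk; have [[okp _] _ _] := hp; have ox := ordinal_el okp xk.
split=> // nxk; apply: Hb hp _ xk => //.
by have [|//] := ordinal_sub_or_mem (regular_ordinal rk) ox.
Qed.

Lemma canF_lt b k xi a : xi ∈ k -> canF b k xi a = elts xi.
Proof. by move=> xk; rewrite /canF; case: asboolP. Qed.

Lemma canF_ge b k xi a : ~ xi ∈ k -> canF b k xi a = b k xi @` elts a.
Proof.
move=> nxk; rewrite /canF; case: asboolP => // _.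
by apply/seteqP; split=> y [i ia]; [move=> ->|move=> <-]; exists i.
Qed.

Lemma canF_sub b k xi a : canonical_at b k xi -> a ⊆ k ->
  canF b k xi a `<=` elts xi.
Proof.
move=> [_ xb] ak; have [xk|nxk] := pselect (xi ∈ k); first by rewrite canF_lt.
by rewrite canF_ge // => _ [i /ak ik <-]; have [+ _ _] := xb nxk; apply.
Qed.

Lemma canf_collapse b k xi a : canonical_at b k xi -> a ⊆ k ->
  is_collapse (canF b k xi a) (canf b k xi a, canpi b k xi a).
Proof.
move=> cx ak; rewrite /canf /canpi -surjective_pairing.
by apply: (collapseP (x := xi)); [case: cx|exact: canF_sub].
Qed.

Lemma canf_eq b k xi a tp : is_collapse (canF b k xi a) tp ->
  canf b k xi a = tp.1 /\ forall x, canF b k xi a x -> canpi b k xi a x = tp.2 x.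
Proof. exact: collapse_eq. Qed.

Lemma ordinal_canf b k xi a : canonical_at b k xi -> a ⊆ k ->
  ordinal (canf b k xi a).
Proof.
move=> cx ak; apply: (is_collapse_ordinal _ _ (canf_collapse cx ak)) => //.
  exact: cx.1.
exact: canF_sub.
Qed.

Lemma canf_surj b k xi a w : canonical_at b k xi -> a ⊆ k ->
  w ∈ canf b k xi a -> exists2 y, canF b k xi a y & canpi b k xi a y = w.
Proof. by move=> cx ak wf; have [_ [_ _ /(_ w wf)]] := canf_collapse cx ak. Qed.

Lemma canpi_in b k xi a y : canonical_at b k xi -> a ⊆ k ->
  canF b k xi a y -> canpi b k xi a y ∈ canf b k xi a.
Proof. by move=> cx ak; have [_ [h _ _] _] := canf_collapse cx ak; exact: h. Qed.

Lemma canf_lt b k xi a : canonical_at b k xi -> xi ∈ k -> canf b k xi a = xi.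
Proof.
move=> [[tx _] _] xk; have := @canf_eq b k xi a; rewrite canF_lt // => /(_ (xi, id)).
by case; first exact: is_collapse_transitive.
Qed.

Lemma canf_initial b k xi a y : canonical_at b k xi -> a ⊆ k ->
  canF b k xi a y -> canF b k y a = canF b k xi a `&` elts y ->
  canf b k y a = canpi b k xi a y.
Proof.
move=> cx ak Fy e; have oy := ordinal_el cx.1 (canF_sub cx ak Fy).
have h := is_collapse_initial oy.1 (canf_collapse cx ak) Fy.
by rewrite -e in h; have [] := canf_eq h.
Qed.

Lemma canF_coherent b k xi y : regular k -> canonical_at b k xi ->
  canonical_at b k y -> ~ xi ∈ k -> y ∈ xi ->
  large k [set a | canF b k y a = canF b k xi a `&` elts y].
Proof.
move=> rk [ox xb] [oy yb] nxk yx; have ok := regular_ordinal rk.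
have eb := xb nxk; have [e1 _ _] := eb.
have [e' [h1 h2 h3]] := set_bij_inverse eb.
(* For [y] below [k], F_y(a) is [y] itself, and the indices of its elements under [b k xi] are
   bounded in [k] by regularity. *)
have [yk|nyk] := pselect (y ∈ k).
  have [i iy|g gk gP] := regular_sup (f := e') rk yk.
    by apply: h1; exact: ordinal_trans iy.
  apply: large_sub (large_gt gk) _ => a ak la /= ga; rewrite canF_lt // canF_ge //.
  apply/seteqP; split=> [w wy|w []//]; split=> //.
  have oa := ordinal_el ok ak.
  exists (e' w); last by apply: h2; exact: ordinal_trans wy.
  exact: ordinal_trans oa ga (gP _ wy).
have cb := yb nyk; have [c1 _ _] := cb.
have [c' [k1 k2 k3]] := set_bij_inverse cb.
have cx i : i ∈ k -> b k y i ∈ xi by move=> /c1; exact: ordinal_trans yx.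
have l1 : large k [set a | forall i, i ∈ a -> e' (b k y i) ∈ a].
  by apply: large_fun => i /cx/h1.
(* [d] turns an index under [b k xi] into an index under [b k y]; the default [i] imposes nothing
   when the value is outside [y]. *)
pose d i := if pselect (b k xi i ∈ y) then c' (b k xi i) else i.
have l2 : large k [set a | forall i, i ∈ a -> d i ∈ a].
  by apply: large_fun => i ik; rewrite /d; case: pselect => [h|_ //]; exact: k1.
apply: large_sub (large_and rk l1 l2) _ => a ak la [g1 g2].
rewrite /= !canF_ge //; apply/seteqP; split=> [_ [i ia <-]|w [[i ia <-] wy]].
  have ik := ordinal_trans ok ak ia.
  split; last exact: c1.
  by exists (e' (b k y i)); [exact: g1|apply: h2; exact: cx].
have := g2 _ ia; rewrite /d; case: pselect => [h|//].
by exists (c' (b k xi i)); last exact: k2.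
Qed.

(** The elements of F_xi(a) are the [b k xi i] with [i] in [a], so a diagonal intersection over [i]
    treats them all at once. *)
Lemma canF_coherent_diag b k xi : regular k ->
  (forall y, y ∈ succ xi -> canonical_at b k y) -> ~ xi ∈ k ->
  large k [set a | forall y, canF b k xi a y ->
    canF b k y a = canF b k xi a `&` elts y].
Proof.
move=> rk cx nxk; have cxi := cx _ (mem_succ_self _); have [ox xb] := cxi.
have [f1 _ _] := xb nxk.
have := large_diag (X := fun i => [set a |
  canF b k (b k xi i) a = canF b k xi a `&` elts (b k xi i)]) rk.
move=> /(_ _)/large_sub; apply=> [i ik|a ak la h].
  have yx := f1 _ ik; apply: canF_coherent => //.
  by apply: cx; apply/mem_succ; left.
by move=> y; rewrite {1}canF_ge // => -[i ia <-]; exact: h.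
Qed.

Lemma large_canF_mem b k xi y : regular k -> canonical_at b k xi -> ~ xi ∈ k ->
  y ∈ xi -> large k [set a | canF b k xi a y].
Proof.
move=> rk [ox xb] nxk yx; have [_ _ f3] := xb nxk; have [i ik e] := f3 _ yx.
by apply: large_sub (large_gt ik) _ => a ak la ia; rewrite /= canF_ge //; exists i.
Qed.

(** For a large set of [a], [z] is the largest element of F_(z+1)(a) and the elements below it form
    F_z(a), so the collapse sends [z] to f_z(a). *)
Lemma canf_succ b k z : regular k -> canonical_at b k z ->
  canonical_at b k (succ z) -> ~ succ z ∈ k ->
  large k [set a | is_succ (canf b k z a) (canf b k (succ z) a)].
Proof.
move=> rk cz cx nxk; have ok := regular_ordinal rk; have zx := mem_succ_self z.
have l1 := large_canF_mem rk cx nxk zx.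
have l2 := canF_coherent rk cx cz nxk zx.
apply: large_sub (large_and rk l1 l2) _ => a ak la [Fz e] w.
have ak' : a ⊆ k by move=> i; exact: ordinal_trans ak.
have Cx := canf_collapse cx ak'.
rewrite (canf_initial cx ak' Fz e); split=> [wf|[wf|->]].
- have [y Fy <-] := canf_surj cx ak' wf.
  have /mem_succ[yz|->] := canF_sub cx ak' Fy; [left|by right].
  by apply/(is_collapse_mem _ Cx) => //; exists y.
- have /(is_collapse_mem _ Cx)[//|y [Fy _ ->]] := wf; exact: canpi_in.
- exact: canpi_in.
Qed.

(** Closure of [a] under the index of the successor of [b k xi i] makes F_xi(a) closed under
    successors, so its order type has no last element. *)
Lemma canf_limit b k xi : regular k -> canonical_at b k xi -> is_limit xi ->
  ~ xi ∈ k -> large k [set a | is_limit (canf b k xi a)].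
Proof.
move=> rk cx lx nxk; have ok := regular_ordinal rk; have [ox xb] := cx.
have eb := xb nxk; have [e1 _ _] := eb.
have [e' [h1 h2 h3]] := set_bij_inverse eb.
have l1 : large k [set a | forall i, i ∈ a -> e' (succ (b k xi i)) ∈ a].
  by apply: large_fun => i /e1 ei; apply: h1; exact: is_limit_succ.
apply: large_sub l1 _ => a ak la g1.
have ak' : a ⊆ k by move=> i; exact: ordinal_trans ak.
have next y : canF b k xi a y -> canF b k xi a (succ y).
  rewrite !canF_ge // => -[i ia <-]; exists (e' (succ (b k xi i))); first exact: g1.
  by apply: h2; apply: is_limit_succ => //; apply: e1; exact: ak'.
split=> [||w /(canf_surj cx ak')[y Fy <-]]; first exact: ordinal_canf.
  exists (canpi b k xi a (b k xi V0)); apply: canpi_in => //.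
  by rewrite canF_ge //; exists V0 => //; exact: V0_in_limit.
exists (canpi b k xi a (succ y)); first by apply: canpi_in => //; exact: next.
have Cx := canf_collapse cx ak'; apply/(is_collapse_mem _ Cx); first exact: next.
by exists y; split=> //; exact: mem_succ_self.
Qed.

Lemma canonical_bij_collapse b k xi a : canonical_at b k xi -> a ⊆ k ->
  ~ xi ∈ k ->
  set_bij (elts a) (elts (canf b k xi a)) (canpi b k xi a \o b k xi).
Proof.
move=> cx ak nxk; have [ox xb] := cx; have eb := xb nxk.
apply: (@set_bij_comp _ _ _ _ (canF b k xi a)); last by case: (canf_collapse cx ak).
rewrite canF_ge //; split=> [i ia|i j|//]; first by exists i.
by rewrite !inE => /ak ik /ak jk; exact: set_bij_inj eb ik jk.
Qed.

(** The order type is equinumerous with the cardinal [a]. Hence a restricted formula of level at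
    least [k] has level at least [a], and restricting it again falls under the same clause. *)
Lemma canf_notin b k xi a : canonical_at b k xi -> a ⊆ k -> ~ xi ∈ k ->
  cardinal a -> ~ canf b k xi a ∈ a.
Proof.
move=> cx ak nxk [_ ca] /ca; apply.
exact: set_bij_card (canonical_bij_collapse cx ak nxk).
Qed.

Lemma canonical_at_canf b k xi a : canonical_bijections b -> regular k ->
  canonical_at b k xi -> ~ xi ∈ k -> a ∈ k -> regular a ->
  canonical_at b a (canf b k xi a).
Proof.
move=> Hb rk cx nxk ak ra; have ok := regular_ordinal rk.
have ak' : a ⊆ k by move=> i; exact: ordinal_trans ak.
have [ck _ _] := rk; have [ap hp] := card_succ_exists ck ak.
apply: (canonical_atP Hb ra hp).
apply: ordinal_card_succ hp (ordinal_canf cx ak') _.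
exact: set_bij_card (canonical_bij_collapse cx ak' nxk).
Qed.

(** Both [b a (canf b k xi a)] and the collapse of [b k xi] restricted to [a]
    are bijections from [a] onto [canf b k xi a], so their images agree at a
    club of [c < a]. *)
Lemma canf_canf b k xi a : canonical_bijections b -> regular k ->
  canonical_at b k xi -> ~ xi ∈ k -> a ∈ k -> regular a ->
  large a [set c | let eta := canf b k xi a in
    [/\ canf b k xi c = canf b a eta c,
        canF b a eta c = canpi b k xi a @` canF b k xi c
      & forall y, canF b k xi c y ->
          canpi b a eta c (canpi b k xi a y) = canpi b k xi c y]].
Proof.
move=> Hb rk cx nxk ak ra; have ok := regular_ordinal rk.
have ak' : a ⊆ k by move=> i; exact: ordinal_trans ak.
have ce := canonical_at_canf Hb rk cx nxk ak ra.
have nea : ~ canf b k xi a ∈ a by apply: canf_notin => //; case: ra.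
have eb := canonical_bij_collapse cx ak' nxk.
apply: large_sub (large_bij ra eb (ce.2 nea)) _ => c ca lc /= e.
have oa := ordinal_el ok ak.
have ca' : c ⊆ a by move=> i; exact: ordinal_trans ca.
have ck' : c ⊆ k by move=> i /ca'/ak'.
have FF : canF b a (canf b k xi a) c = canpi b k xi a @` canF b k xi c.
  by rewrite !canF_ge // -e image_comp.
have Fca y : canF b k xi c y -> canF b k xi a y.
  by rewrite !canF_ge // => -[i /ca' ia <-]; exists i.
have [_ pb pm] := canf_collapse cx ak'.
have pb' : set_bij (canF b k xi c) (canF b a (canf b k xi a) c) (canpi b k xi a).
  rewrite FF; split=> [y Fy|y z|//]; first by exists y.
  by rewrite !inE => /Fca Fy /Fca Fz; exact: set_bij_inj pb Fy Fz.
have pm' y z : canF b k xi c y -> canF b k xi c z ->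
    (y ∈ z <-> canpi b k xi a y ∈ canpi b k xi a z).
  by move=> /Fca Fy /Fca Fz; exact: pm.
have [e1 e2] := canf_eq (is_collapse_iso pb' pm' (canf_collapse ce ca')).
by split=> // y Fy; rewrite e2.
Qed.

(** * Formulas *)

(** Parameters and variables are all read off occurrences, so this induction serves [par1_cut],
    [free2_cut] and [par2_cut] alike. *)
Lemma occ_cut a p t : occ (cut_fo a p) t <-> exists2 u, occ p u & t = cut_term a u.
Proof.
have two u v w : [set cut_term a u; cut_term a v] w <->
    exists2 t, [set u; v] t & w = cut_term a t.
  split=> [[->|->]|[t' [->|->] ->]];
    by [exists u; [left|]|exists v; [right|]|left|right].
have bin p1 p2 : (occ (cut_fo a p1) t <-> exists2 u, occ p1 u & t = cut_term a u) ->
    (occ (cut_fo a p2) t <-> exists2 u, occ p2 u & t = cut_term a u) ->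
    (occ (cut_fo a p1) `|` occ (cut_fo a p2)) t <->
    exists2 u, (occ p1 `|` occ p2) u & t = cut_term a u.
  move=> h1 h2; split=> [[/h1|/h2] [u pu ->]|[u [pu|pu] e]].
  - by exists u => //; left.
  - by exists u => //; right.
  - by left; apply/h1; exists u.
  - by right; apply/h2; exists u.
by elim: p => [u v|u v|p IH|p IHp q IHq|p IHp q IHq|p IHp q IHq|n p IH|n p IH] //=;
  first [exact: two|exact: IH|exact: bin].
Qed.

Lemma par1_cut a phi : par1 (cut a phi) = par1 phi.
Proof.
elim: phi => [p|s n phi IH|s xi psi IH] //=; apply/seteqP; split=> x /=.
- by move=> /occ_cut[[]// y yp [->]].
- by move=> xp; apply/occ_cut; exists (Par1 x).
- by move=> [i]; rewrite IH; exists i.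
- by move=> [i pi]; exists i; rewrite IH.
Qed.

Lemma free2_cut a phi : free2 (cut a phi) = free2 phi.
Proof.
elim: phi => [p|s n phi IH|s xi psi IH] /=; [|by rewrite IH|];
  apply/seteqP; split=> x /=.
- by move=> /occ_cut[[]// y yp [->]].
- by move=> xp; apply/occ_cut; exists (Var2 x).
- by move=> [i]; rewrite IH; exists i.
- by move=> [i pi]; exists i; rewrite IH.
Qed.

Lemma par2_cut a phi : par2 (cut a phi) = (fun A => A `&` cumul a) @` par2 phi.
Proof.
elim: phi => [p|s n phi IH|s xi psi IH] //=; apply/seteqP; split=> A /=.
- by move=> /occ_cut[[]// B pB [->]]; exists B.
- by move=> [B pB <-]; apply/occ_cut; exists (Par2 B).
- by move=> [i]; rewrite IH => -[B pB <-]; exists B => //; exists i.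
- by move=> [B [i pB] <-]; exists i; rewrite IH; exists B.
Qed.

(** Cutting places every second-order parameter inside V_a, so only first-order ones can
    obstruct. *)
Lemma over_cut a phi : over a (cut a phi) <-> par1 phi `<=` cumul a.
Proof.
rewrite /over par1_cut par2_cut; split=> [[]//|h]; split=> // _ [B _ <-].
exact: subIsetr.
Qed.

Lemma cut_cut a c phi : cumul c `<=` cumul a -> cut c (cut a phi) = cut c phi.
Proof.
move=> ca; have ct t : cut_term c (cut_term a t) = cut_term c t.
  case: t => //= A; congr Par2; apply/seteqP; split=> [x [[]]|x [Ax cx]] //.
  by split=> //; split=> //; exact: ca.
elim: phi => [p|s n phi IH|s xi psi IH] //=; first 1 last.
- by rewrite IH.
- by congr Big; apply/funext=> i.
congr FO.
elim: p => [t u|t u|p IH|p IHp q IHq|p IHp q IHq|p IHp q IHq|n p IH|n p IH] /=;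
  by rewrite ?ct ?IH ?IHp ?IHq.
Qed.

Lemma par1_quants s ks psi : par1 (quants s ks psi) = par1 psi.
Proof. by elim: ks. Qed.

Lemma par2_quants s ks psi : par2 (quants s ks psi) = par2 psi.
Proof. by elim: ks. Qed.

Lemma free2_quants s ks phi psi : free2 phi `<=` free2 psi ->
  free2 (quants s ks phi) `<=` free2 (quants s ks psi).
Proof. by move=> h; elim: ks => //= n ks IH; exact: setSD. Qed.

Lemma cut_quants a s ks psi : cut a (quants s ks psi) = quants s ks (cut a psi).
Proof. by elim: ks => //= n ks ->. Qed.

Lemma cut_over_quants a s ks psi :
  cut_over a (quants s ks psi) = omap (quants s ks) (cut_over a psi).
Proof.
have e : over a (cut a (quants s ks psi)) = over a (cut a psi).
  by apply/propext; rewrite !over_cut par1_quants.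
by rewrite /cut_over e; case: ifP => //= _; rewrite cut_quants.
Qed.

Lemma restr_quants b k a s ks psi :
  restr b k a (quants s ks psi) = omap (quants s ks) (restr b k a psi).
Proof. by elim: ks => [|n ks /= ->]; case: (restr b k a psi). Qed.

Lemma lev_cut k s xi phi a : lev k s xi phi -> par1 phi `<=` cumul a ->
  lev a s xi (cut a phi).
Proof.
elim=> {s xi phi} [s xi p z _ h|s z xi ks psi zx _ IH|s xi psi lx f2 p2 _ IH h].
- by apply: lev_zero z _; exact/(over_cut a (FO p)).
- by rewrite par1_quants cut_quants => /IH; exact: lev_succ zx.
- have e2 := free2_cut a (Big s psi); have e3 := par2_cut a (Big s psi).
  apply: (@lev_limit a s xi (fun i => cut a (psi i))) => //.
  + by rewrite -[Big _ _]/(cut a (Big s psi)) e2.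
  + by rewrite -[Big _ _]/(cut a (Big s psi)) e3; exact: finite_image.
  + by move=> i; apply: IH => x xp; apply: h; exists i.
Qed.

(** * Restriction below level [k] and of long conjunctions and disjunctions *)

Lemma restr_lt b k a s xi phi : ordinal k -> lev k s xi phi -> xi ∈ k ->
  restr b k a phi = cut_over a phi.
Proof.
move=> ok; elim=> {s xi phi} [//|s z xi ks psi zx _ IH xk|s xi psi _ _ _ _ _ xk /=].
  rewrite restr_quants cut_over_quants IH //; apply: ordinal_trans xk _ => //.
  by apply/zx; right.
by case: asboolP.
Qed.

(** A first-order formula has finitely many parameters, each of bounded rank; at limit levels below
    [k], regularity bounds the bounds. *)
Lemma par1_bounded k s xi phi : regular k -> lev k s xi phi -> xi ∈ k ->
  exists2 g, g ∈ k & par1 phi `<=` cumul g.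
Proof.
move=> rk; have ok := regular_ordinal rk; have lk := regular_limit rk.
have max2 (P Q : set V) : (P `<=` cumul k -> exists2 g, g ∈ k & P `<=` cumul g) ->
    (Q `<=` cumul k -> exists2 g, g ∈ k & Q `<=` cumul g) ->
    P `|` Q `<=` cumul k -> exists2 g, g ∈ k & P `|` Q `<=` cumul g.
  move=> hP hQ PQ; have [|g gk Pg] := hP; first by move=> x Px; apply: PQ; left.
  have [|h hk Qh] := hQ; first by move=> x Qx; apply: PQ; right.
  have [m [mk gm hm]] := regular_max rk gk hk; have om := ordinal_el ok mk.
  by exists m => // x [/Pg|/Qh]; exact: cumul_sub.
have ter t : [set x | Par1 x = t] `<=` cumul k ->
    exists2 g, g ∈ k & [set x | Par1 x = t] `<=` cumul g.
  (* Only the term [Par1 y] contributes a parameter; the bound [V0] in the other cases is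
     arbitrary. *)
  case: t => [n|y|n|A] h; [by exists V0 => //; exact: V0_in_limit| |
    by exists V0 => //; exact: V0_in_limit|by exists V0 => //; exact: V0_in_limit].
  have ky : cumul k y by apply: h.
  case: ky lk {rk ok max2 h} => k' c z ck h lk; exists (succ c).
    exact: is_limit_succ.
  by move=> _ [->]; apply: cumul_intro h; exact: mem_succ_self.
elim=> {s xi phi} [s xi p _ [+ _] _|s z xi ks psi zx _ IH xk|s xi psi _ _ _ _ IH xk].
- elim: p => [u v|u v|p IH|p IHp q IHq|p IHp q IHq|p IHp q IHq|n p IH|n p IH] //=.
  1,2: exact: (max2 _ _ (ter u) (ter v)).
  1-3: exact: (max2 _ _ IHp IHq).
- by rewrite par1_quants; apply: IH; apply: ordinal_trans xk _ => //; apply/zx; right.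
- have [|g gk gP] := @regular_bound k xi (fun i g => par1 (psi i) `<=` cumul g) rk xk.
    by move=> i; apply: IH; exact: ordinal_trans xk (svalP i).
  exists g => // x [i xi_]; have [h hg hP] := gP i.
  exact: cumul_sub (ordinal_el ok gk) hg _ (hP _ xi_).
Qed.

(** [eta] is kept as a variable so that [chi] need not be transported along
    [eta = canf b k xi a]. *)
Lemma restr_Big b k a s xi (psi : el xi -> form) eta (chi : el eta -> form) :
  ~ xi ∈ k -> eta = canf b k xi a ->
  (forall w, w ∈ eta -> exists y : el xi,
     canF b k xi a (sval y) /\ canpi b k xi a (sval y) = w) ->
  (forall (y : el xi) (z : el eta),
     canF b k xi a (sval y) -> canpi b k xi a (sval y) = sval z ->
     restr b k a (psi y) = Some (chi z) /\ lev a s (sval z) (chi z)) ->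
  restr b k a (Big s psi) = Some (Big s chi).
Proof.
move=> nxk e; subst eta => surj H /=; case: asboolP => // _.
case: pselect => [h|[]]; last by exists chi.
congr (Some (Big s _)); apply/funext => z.
have [y [Fy yz]] := surj _ (svalP z).
have [e1 _] := H y z Fy yz; have [e2 _] := svalP (cid h) y z Fy yz.
by move: e2; rewrite e1 => -[].
Qed.

Lemma restr_Big_inv b k a s xi (psi : el xi -> form) theta :
  ~ xi ∈ k -> restr b k a (Big s psi) = Some theta ->
  exists2 chi : el (canf b k xi a) -> form, theta = Big s chi &
    forall (y : el xi) (z : el (canf b k xi a)),
      canF b k xi a (sval y) -> canpi b k xi a (sval y) = sval z ->
      restr b k a (psi y) = Some (chi z) /\ lev a s (sval z) (chi z).
Proof.
move=> nxk /=; case: asboolP => // _.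
case: pselect => // h [<-]; exists (sval (cid h)) => //; exact: svalP (cid h).
Qed.

(** * Restrictions at a club *)

(** The last two conditions keep the sets of second-order parameters and free
    variables finite at limit levels. *)
Definition restrictable b k s xi phi : set V :=
  [set a | exists chi, [/\ restr b k a phi = Some chi,
     lev a s (canf b k xi a) chi,
     par2 chi `<=` (fun A => A `&` cumul a) @` par2 phi
   & free2 chi `<=` free2 phi]].

Lemma restrictable_lt b k s xi phi : regular k -> canonical_at b k xi ->
  lev k s xi phi -> xi ∈ k -> large k (restrictable b k s xi phi).
Proof.
move=> rk cx lphi xk; have ok := regular_ordinal rk.
have [g gk pg] := par1_bounded rk lphi xk.
apply: large_sub (large_gt gk) _ => a ak la ga.
have pa : par1 phi `<=` cumul a.
  by move=> x /pg; apply: cumul_sub ga _; exact: ordinal_el ak.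
exists (cut a phi); rewrite (restr_lt b a ok lphi xk) canf_lt //; split.
- by rewrite /cut_over; case: asboolP => // -[]; apply/over_cut.
- exact: lev_cut lphi pa.
- by rewrite par2_cut.
- by rewrite free2_cut.
Qed.

Lemma restrictable_succ b k s z xi ks psi : regular k ->
  canonical_at b k z -> canonical_at b k xi -> ~ xi ∈ k -> is_succ z xi ->
  large k (restrictable b k (dual s) z psi) ->
  large k (restrictable b k s xi (quants s ks psi)).
Proof.
move=> rk cz cx nxk zx IH; have e := is_succE zx; subst xi.
apply: large_sub (large_and rk IH (canf_succ rk cz cx nxk)) _.
move=> a ak la [[chi [r l p f]] sf]; exists (quants s ks chi).
rewrite restr_quants r /=; split=> //.
- exact: lev_succ sf l.
- by rewrite !par2_quants.
- exact: free2_quants.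
Qed.

Lemma large_canF_diag b k xi (X : el xi -> set V) : regular k ->
  canonical_at b k xi -> ~ xi ∈ k -> (forall y, large k (X y)) ->
  large k [set a | forall y, canF b k xi a (sval y) -> X y a].
Proof.
move=> rk [ox xb] nxk h; have [f1 _ _] := xb nxk.
have := large_diag (X := fun i => [set a |
  (* Elements of [el xi] carry a membership proof, so index [i] is matched to [y] through its
     underlying set. *)
  forall y : el xi, sval y = b k xi i -> X y a]) rk.
move=> /(_ _)/large_sub; apply=> [i ik|a ak la H y]; last first.
  by rewrite canF_ge // => -[i ia e]; apply: (H i ia).
pose y : el xi := exist (fun y => y ∈ xi) _ (f1 _ ik).
apply: large_sub (h y) _ => a _ _ Xa [y' y'x] /= e; subst y'.
by rewrite (Prop_irrelevance y'x (f1 _ ik)).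
Qed.

(** The component at [z] is the restriction of [psi y] for the unique [y] collapsed to [z];
    coherence shows that its level f_y(a) is [z]. *)
Lemma restrictable_limit b k s xi (psi : el xi -> form) : regular k ->
  (forall y, y ∈ succ xi -> canonical_at b k y) -> ~ xi ∈ k -> is_limit xi ->
  finite_set (free2 (Big s psi)) -> finite_set (par2 (Big s psi)) ->
  (forall i, large k (restrictable b k s (sval i) (psi i))) ->
  large k (restrictable b k s xi (Big s psi)).
Proof.
move=> rk cy nxk lx f2 p2 IH; have ok := regular_ordinal rk.
have cx := cy _ (mem_succ_self _).
have l1 := large_canF_diag rk cx nxk IH.
have l2 := canF_coherent_diag rk cy nxk.
have l3 := canf_limit rk cx lx nxk.
apply: large_sub (large_and rk l1 (large_and rk l2 l3)) _.
move=> a ak la [h1 [h2 h3]]; have ak' : a ⊆ k by move=> i; exact: ordinal_trans ak.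
have [_ pb _] := canf_collapse cx ak'.
have surj w : w ∈ canf b k xi a ->
    exists y : el xi, canF b k xi a (sval y) /\ canpi b k xi a (sval y) = w.
  move=> /(canf_surj cx ak')[y Fy e].
  by exists (exist (fun y => y ∈ xi) _ (canF_sub cx ak' Fy)).
pose A (z : el (canf b k xi a)) chi := exists y : el xi,
  [/\ canF b k xi a (sval y), canpi b k xi a (sval y) = sval z,
      restr b k a (psi y) = Some chi, lev a s (sval z) chi
    & par2 chi `<=` (fun A => A `&` cumul a) @` par2 (psi y) /\
      free2 chi `<=` free2 (psi y)].
have AP z : exists chi, A z chi.
  have [y [Fy e]] := surj _ (svalP z); have [chi [r l p f]] := h1 y Fy.
  exists chi, y; split=> //; rewrite -e -(canf_initial cx ak' Fy) //; exact: h2.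
have [chi chiP] := choice AP.
have fin1 : free2 (Big s chi) `<=` free2 (Big s psi).
  by move=> n [z]; have [y [_ _ _ _ [_ f]]] := chiP z; move=> /f ny; exists y.
have fin2 : par2 (Big s chi) `<=` (fun A => A `&` cumul a) @` par2 (Big s psi).
  move=> B [z]; have [y [_ _ _ _ [p _]]] := chiP z; move=> /p[C Cy <-].
  by exists C => //; exists y.
exists (Big s chi); split=> //.
- apply: restr_Big surj _ => // y z Fy e; have [y' [Fy' e' r l _]] := chiP z.
  (* The collapse is injective on F_xi(a), so the index chosen for [z] is the given one. *)
  have yy' : y = y'.
    have : sval y = sval y' by apply: set_bij_inj pb Fy Fy' _; rewrite /= e.
    case: y y' {Fy e Fy' e' r} => y yx [y' y'x] /= ey; subst y'.
    by rewrite (Prop_irrelevance yx y'x).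
  by rewrite yy'.
- apply: lev_limit => //; first exact: sub_finite_set fin1 f2.
    by apply: sub_finite_set fin2 _; exact: finite_image.
  by move=> z; have [y [_ _ _ l _]] := chiP z.
Qed.

Lemma large_restrictable b k kp s xi phi : canonical_bijections b ->
  regular k -> card_succ k kp -> xi ∈ kp -> lev k s xi phi ->
  large k (restrictable b k s xi phi).
Proof.
move=> Hb rk hp xkp lphi; have [[okp _] _ _] := hp; have lk := regular_limit rk.
have can y : y ∈ kp -> canonical_at b k y by exact: canonical_atP hp.
elim: lphi xkp => {s xi phi}.
- move=> s xi p z o xkp; apply: restrictable_lt => //; first exact: can.
    exact: lev_zero.
  by rewrite (is_zeroE z); exact: V0_in_limit.
- move=> s z xi ks psi zx lpsi IH xkp; have cx := can _ xkp.
  have zkp : z ∈ kp by apply: ordinal_trans xkp _ => //; apply/zx; right.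
  have [xk|nxk] := pselect (xi ∈ k).
    by apply: restrictable_lt => //; exact: lev_succ zx lpsi.
  exact: (restrictable_succ ks rk (can _ zkp) cx nxk zx (IH zkp)).
- move=> s xi psi lx f2 p2 lpsi IH xkp; have cx := can _ xkp.
  have [xk|nxk] := pselect (xi ∈ k).
    by apply: restrictable_lt => //; exact: lev_limit.
  apply: restrictable_limit => // [y /mem_succ[yx|->//]|i].
    by apply: can; exact: ordinal_trans yx.
  by apply: IH; exact: ordinal_trans (svalP i).
Qed.

(** * Commutation of successive restrictions *)

(** Both restrictions to [a] and to [c] are assumed defined, which separates this induction from
    that of [restrictable]. Regularity of [a] is asked because [b a] is canonical only then. *)
Definition restr_commutes b k phi : set V :=
  [set a | regular a -> large a [set c | forall chi theta,
     restr b k a phi = Some chi -> restr b k c phi = Some theta ->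
     restr b a c chi = Some theta]].

(** Once [xi] is below [c] and [a], all three restrictions are cuts, and cutting at [a] before [c]
    changes nothing. *)
Lemma restr_commutes_lt b k s xi phi : regular k -> canonical_at b k xi ->
  lev k s xi phi -> xi ∈ k -> large k (restr_commutes b k phi).
Proof.
move=> rk cx lphi xk; have ok := regular_ordinal rk.
apply: large_sub (large_gt xk) _ => a ak la xa ra.
have oa := regular_ordinal ra.
apply: large_sub (large_gt xa) _ => c ca lc xc chi theta.
rewrite !(restr_lt b _ ok lphi xk) /cut_over.
case: asboolP => // /over_cut oa' [<-]; case: asboolP => // /over_cut oc [<-].
rewrite (restr_lt b c oa (lev_cut lphi oa') xa) /cut_over.
rewrite cut_cut; last exact: cumul_sub.
by case: asboolP => // -[]; apply/over_cut.
Qed.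

Lemma restr_commutes_quants b k s ks psi : large k (restr_commutes b k psi) ->
  large k (restr_commutes b k (quants s ks psi)).
Proof.
move=> h; apply: large_sub h _ => a ak la h ra.
apply: large_sub (h ra) _ => c ca lc {}h chi theta; rewrite !restr_quants.
case ea: (restr b k a psi) => [chi'|] //= [<-].
case ec: (restr b k c psi) => [theta'|] //= [<-].
by rewrite restr_quants (h _ _ ea ec).
Qed.

Lemma restr_commutes_limit b k s xi (psi : el xi -> form) :
  canonical_bijections b -> regular k -> canonical_at b k xi -> ~ xi ∈ k ->
  (forall i, large k (restr_commutes b k (psi i))) ->
  large k (restr_commutes b k (Big s psi)).
Proof.
move=> Hb rk cx nxk IH; have ok := regular_ordinal rk.
apply: large_sub (large_canF_diag rk cx nxk IH) _ => a ak la h1 ra.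
have ak' : a ⊆ k by move=> i; exact: ordinal_trans ak.
have oa := regular_ordinal ra.
have nea : ~ canf b k xi a ∈ a by apply: canf_notin => //; case: ra.
(* The diagonal intersection is now taken inside [a]: one large set of [c] serves every [psi y]
   whose index lies below [c]. *)
have l1 : large a [set c | forall i, i ∈ c -> forall y : el xi,
    sval y = b k xi i -> forall chi theta, restr b k a (psi y) = Some chi ->
    restr b k c (psi y) = Some theta -> restr b a c chi = Some theta].
  apply: large_diag => // i ia.
  have [ix|nix] := pselect (b k xi i ∈ xi); last first.
    by exists id => // c _ y e; case: nix; rewrite -e; exact: (svalP y).
  pose y : el xi := exist (fun y => y ∈ xi) _ ix.
  have Fy : canF b k xi a (sval y) by rewrite canF_ge //; exists i.
  apply: large_sub (h1 y Fy ra) _ => c _ _ h [y' y'x] /= e; subst y'.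
  by rewrite (Prop_irrelevance y'x ix).
apply: large_sub (large_and ra l1 (canf_canf Hb rk cx nxk ak ra)) _.
move=> c ca lc [h2 [e1 FF e2]] chi0 theta0.
have ca' : c ⊆ a by move=> i; exact: ordinal_trans ca.
have ck' : c ⊆ k by move=> i /ca'/ak'.
move=> /(restr_Big_inv nxk)[chi -> chiP] /(restr_Big_inv nxk)[theta -> thetaP].
have Fca y : canF b k xi c y -> canF b k xi a y.
  by rewrite !canF_ge // => -[i /ca' ia <-]; exists i.
apply: restr_Big => // [w wc|z w].
  have [y Fy <-] := canf_surj cx ck' wc.
  exists (exist (fun z => z ∈ canf b k xi a) _ (canpi_in cx ak' (Fca _ Fy))) => /=.
  by rewrite e2 // FF; split=> //; exists y.
(* An index selected at [c] from the formula restricted to [a] is the image of some [y] in F_xi(c),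
   and both routes restrict [psi y]. *)
rewrite FF => -[y Fy yz] zw; have yx := canF_sub cx ck' Fy.
pose y' : el xi := exist (fun y => y ∈ xi) _ yx.
have [r1 _] := chiP y' z (Fca _ Fy) yz.
have [|r2 l2] := thetaP y' w Fy; first by rewrite -zw -yz e2.
split=> //; move: (Fy); rewrite canF_ge // => -[i ic ey].
exact: (h2 i ic y' (esym ey) _ _ r1 r2).
Qed.

Lemma large_restr_commutes b k kp s xi phi : canonical_bijections b ->
  regular k -> card_succ k kp -> xi ∈ kp -> lev k s xi phi ->
  large k (restr_commutes b k phi).
Proof.
move=> Hb rk hp xkp lphi; have [[okp _] _ _] := hp; have lk := regular_limit rk.
have can y : y ∈ kp -> canonical_at b k y by exact: canonical_atP hp.
elim: lphi xkp => {s xi phi}.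
- move=> s xi p z o xkp; apply: (@restr_commutes_lt _ _ s xi) => //; first exact: can.
    exact: lev_zero.
  by rewrite (is_zeroE z); exact: V0_in_limit.
- move=> s z xi ks psi zx lpsi IH xkp; apply: restr_commutes_quants.
  by apply: IH; apply: ordinal_trans xkp _ => //; apply/zx; right.
- move=> s xi psi lx f2 p2 lpsi IH xkp; have cx := can _ xkp.
  have [xk|nxk] := pselect (xi ∈ k).
    by apply: (@restr_commutes_lt _ _ s xi) => //; exact: lev_limit.
  apply: restr_commutes_limit => // i.
  by apply: IH; exact: ordinal_trans (svalP i).
Qed.

Unset Implicit Arguments.

Theorem proposition5p12 (b : V -> V -> V -> V) (Hb : canonical_bijections b)
    (kappa : V) (Hkappa : weakly_mahlo kappa)
    (kappa_plus : V) (Hplus : card_succ kappa kappa_plus)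
    (xi : V) (Hxi : xi ∈ kappa_plus)
    (s : side) (phi : form) (Hphi : lev kappa s xi phi) :
  exists2 D : set V, club kappa D &
    forall alpha : V, D alpha -> regular alpha -> uncountable alpha ->
      exists2 chi : form, restricts b kappa s xi phi alpha chi &
        club_filter alpha
          [set beta | beta ∈ alpha /\
            exists2 theta : form,
              restricts b alpha s (canf b kappa xi alpha) chi beta theta &
              restricts b kappa s xi phi beta theta].
Proof.
have [rk unc _] := Hkappa; have ok := regular_ordinal rk.
have lr := large_restrictable Hb rk Hplus Hxi Hphi.
have lc := large_restr_commutes Hb rk Hplus Hxi Hphi.
(* Reflection ensures that, for a large set of [c] below [a], the restriction of [phi] to [c] is
   defined, as commutation presupposes. *)
have [g gk gP] := large_and rk lr (large_and rk (large_reflect ok lr) lc).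
exists (closure_points kappa g); first exact: closure_points_club.
move=> a /gP[[chi [r l _ _]] [lra lca]] ra ua; exists chi => //.
have [h ha hP] := large_and ra lra (lca ra).
split=> [c []//|]; exists (closure_points a h); first exact: closure_points_club.
move=> c ch; have [ca _ _] := ch; split=> //.
have [[theta [rt _ _ _]] com] := hP c ch.
by exists theta; split=> //; exact: com.
Qed.
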